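(* For any prime $p$, the following hold. (1) The ring $U_p$ of upper triangular $2\times 2$ matrices over $F_p$ is minimal noncommutative. (2) For integers $n\geq 2$ and $1\leq i\leq n-1$, the ring \[B_{p,n,i}=\left\{\begin{pmatrix}x^{p^i}&y\\0&x\end{pmatrix}: x,y\in F_{p^n}\right\}\] is minimal noncommutative if and only if $n=q^m$ and $i=jq^{m-1}$ for some prime $q$ and integers $m\geq 1$ and $1\leq j\leq q-1$.
   Context: All rings are associative with $1$, and subrings contain the identity element. $F_q$ denotes the finite field of order $q$. A ring is minimal noncommutative if it is not commutative but all its proper subrings and all its proper homomorphic images (quotients by nonzero two-sided ideals) are commutative. *)

(* Defs.v *)
From HB Require Import structures.
From mathcomp Require Import all_boot all_algebra all_field.
Set Implicit Arguments. Unset Strict Implicit. Unset Printing Implicit Defensive.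
Import GRing.Theory.
Local Open Scope ring_scope.

(* Up to isomorphism, the quotients of R by nonzero two-sided ideals are the
   surjective images of R under ring morphisms with nonzero kernel.  The target
   ranges over pzRingType so that the zero ring is allowed. *)
Definition minimal_noncommutative (R : pzRingType) : Prop :=
  [/\ ~ commutative (@GRing.mul R),
      forall S : {pred R}, subring_closed S -> (exists x, x \notin S) ->
        {in S &, commutative (@GRing.mul R)}
    & forall (T : pzRingType) (f : {rmorphism R -> T}),
        (forall t, exists x, f x = t) -> (exists2 x, x != 0 & f x = 0) ->
        commutative (@GRing.mul T)].

Section UpperTriangular.
Variable R : nzRingType.

(* is_trig_mx is lower triangularity, hence the transpose. *)
Definition upper_trig : {pred 'M[R]_2} := [pred M | is_trig_mx M^T].

Lemma upper_trigE (M : 'M[R]_2) : (M \in upper_trig) = (M 1 0 == 0).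
Proof.
rewrite inE; apply/is_trig_mxP/eqP => [/(_ 0 1 isT)|M10 i j lt_ij].
  by rewrite mxE.
rewrite mxE -M10; congr (M _ _); apply: val_inj; move: lt_ij => /=;
by case: i j => [[|[|i]] hi] [[|[|j]] hj].
Qed.

Lemma upper_trig_closed : subring_closed upper_trig.
Proof.
split=> [|A B|A B]; rewrite !upper_trigE ?mxE //.
  by move=> /eqP A10 /eqP B10; rewrite ?mxE A10 B10 subr0.
move=> /eqP A10 /eqP B10; rewrite ?mxE !big_ord_recl big_ord0 /=.
have -> : lift ord0 ord0 = 1 :> 'I_2 by apply: val_inj.
by rewrite A10 B10 mul0r mulr0 !addr0.
Qed.

HB.instance Definition _ :=
  GRing.isSubringClosed.Build 'M[R]_2 upper_trig upper_trig_closed.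

Definition upper_trig_ring := {M : 'M[R]_2 | M \in upper_trig}.

HB.instance Definition _ := SubType.on upper_trig_ring.
HB.instance Definition _ := Choice.on upper_trig_ring.
HB.instance Definition _ := [SubChoice_isSubNzRing of upper_trig_ring by <:].

End UpperTriangular.

Definition mx2 (R : Type) (a b c d : R) : 'M[R]_2 :=
  \matrix_(i, j) if i == 0 then (if j == 0 then a else b)
                 else (if j == 0 then c else d).

Section FrobeniusRing.
Variables (F : finFieldType) (p : nat).

(* chF is needed only for closure under subtraction; it is an argument of
   Bpred so that the subring instance can be inferred. *)
Definition Bpred (chF : p \in [pchar F]) (i : nat) : {pred 'M[F]_2} :=
  [pred M | [exists x : F, exists y : F, M == mx2 (x ^+ (p ^ i)) y 0 x]].

Variables (chF : p \in [pchar F]) (i : nat).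

Lemma BpredP (M : 'M[F]_2) :
  reflect (exists x y, M = mx2 (x ^+ (p ^ i)) y 0 x) (M \in Bpred chF i).
Proof.
apply: (iffP existsP) => [[x /existsP[y /eqP ->]]|[x [y ->]]].
  by exists x, y.
by exists x; apply/existsP; exists y.
Qed.

Lemma Bpred_closed : subring_closed (Bpred chF i).
Proof.
have ord2 (k : 'I_2) : k = 0 \/ k = 1.
  by case: k => [[|[|k]] hk] //; [left|right]; apply: val_inj.
have lift1 : lift ord0 ord0 = 1 :> 'I_2 by apply: val_inj.
split=> [|A B /BpredP[x [y ->]] /BpredP[x' [y' ->]]
         |A B /BpredP[x [y ->]] /BpredP[x' [y' ->]]]; apply/BpredP.
- exists 1, 0; apply/matrixP=> k l; rewrite !mxE expr1n.
  by case: (ord2 k) => ->; case: (ord2 l) => ->.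
- exists (x - x'), (y - y'); apply/matrixP=> k l; rewrite !mxE.
  have pF : [pchar F].-nat (p ^ i)%N.
    by rewrite pnatX pnatE ?(pcharf_prime chF) // chF.
  case: (ord2 k) => ->; case: (ord2 l) => -> //=; last exact: subr0.
  by rewrite exprDn_pchar // exprNn_pchar.
- exists (x * x'), (x ^+ (p ^ i) * y' + y * x'); apply/matrixP=> k l.
  rewrite !mxE !big_ord_recl big_ord0 lift1 !mxE.
  case: (ord2 k) => ->; case: (ord2 l) => -> /=;
  by rewrite ?mulr0 ?mul0r ?addr0 ?add0r ?exprMn.
Qed.

HB.instance Definition _ :=
  GRing.isSubringClosed.Build 'M[F]_2 (Bpred chF i) Bpred_closed.

Definition Bring := {M : 'M[F]_2 | M \in Bpred chF i}.

HB.instance Definition _ := SubType.on Bring.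
HB.instance Definition _ := Choice.on Bring.
HB.instance Definition _ := [SubChoice_isSubNzRing of Bring by <:].

End FrobeniusRing.

(* Main.v *)
(* In both rings a commutator is a multiple of e_12, and every nonzero ideal
   contains all the multiples of e_12; so proper quotients are commutative.
   A noncommutative subring contains a nonzero multiple of e_12.  In U_p it
   also contains a matrix with distinct diagonal entries, and these two
   generate U_p.  In B_{p,n,i} it contains a matrix whose diagonal entry a is
   moved by x |-> x^(p^i).  If every proper divisor of n divides i, then a lies
   in no proper subfield of F, so the lower diagonal entries of the subring
   fill F, and the subring is everything.  Conversely, for a proper divisor d of
   n not dividing i, the matrices with lower diagonal entry in F_{p^d} form a
   proper noncommutative subring. *)
Require Import Defs.
From mathcomp Require Import all_boot all_algebra all_field.
From mathcomp Require Import ring.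

Import GRing.Theory.

Section Auxiliary.

Set Implicit Arguments.
Unset Strict Implicit.

Local Open Scope ring_scope.

(** * Quotients and subrings of an arbitrary ring *)

(** A nonzero kernel element [z] generates an ideal containing all commutators, so the image is
    commutative. Single products [u * z * v] are enough for both families of rings below. *)
Lemma noncommutative_quotients (R : pzRingType) :
    (forall z x y : R, z != 0 -> exists u v, u * z * v = x * y - y * x) ->
  forall (T : pzRingType) (f : {rmorphism R -> T}),
    (forall t, exists x, f x = t) -> (exists2 x, x != 0 & f x = 0) ->
    commutative (@GRing.mul T).
Proof.
move=> comm_ideal T f f_surj [z z_neq0 fz0] s t.
have [[x <-] [y <-]] := (f_surj s, f_surj t).
have [u [v uzv]] := comm_ideal z x y z_neq0.
by apply/eqP; rewrite -subr_eq0 -!rmorphM -rmorphB -uzv !rmorphM fz0 mulr0 mul0r.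
Qed.

Lemma subring_closed_addr (R : pzRingType) (S : {pred R}) :
  subring_closed S -> {in S &, forall x y, x + y \in S}.
Proof.
case=> S1 SB _ x y Sx Sy; have S0 : 0 \in S by rewrite -(subrr (1 : R)) SB.
by rewrite -[y]opprK SB // -sub0r SB.
Qed.

Lemma subring_closed_natr (R : pzRingType) (S : {pred R}) n :
  subring_closed S -> n%:R \in S.
Proof.
move=> Scl; have [S1 SB _] := Scl.
elim: n => [|n IHn]; first by rewrite mulr0n -(subrr (1 : R)) SB.
by rewrite -natr1 subring_closed_addr.
Qed.

Lemma subring_closed_expr (R : pzRingType) (S : {pred R}) x n :
  subring_closed S -> x \in S -> x ^+ n \in S.
Proof.
by case=> S1 _ SM Sx; elim: n => [|n IHn]; rewrite ?expr0 // exprS SM.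
Qed.

(** * Entrywise arithmetic of two-by-two matrices *)

Section Matrix2.

Variable R : pzRingType.
Implicit Types a b c d : R.

Lemma ord2 (k : 'I_2) : k = 0 \/ k = 1.
Proof. by case: k => [[|[|k]] hk] //; [left|right]; apply: val_inj. Qed.

Lemma mx2_eta (M : 'M[R]_2) : M = mx2 (M 0 0) (M 0 1) (M 1 0) (M 1 1).
Proof.
apply/matrixP=> k l; rewrite !mxE.
by case: (ord2 k) => ->; case: (ord2 l) => ->.
Qed.

Lemma mx2_inj a b c d a' b' c' d' :
  mx2 a b c d = mx2 a' b' c' d' -> [/\ a = a', b = b', c = c' & d = d'].
Proof.
move=> eqM; split;
  [have := congr1 (fun M : 'M_2 => M 0 0) eqM
  |have := congr1 (fun M : 'M_2 => M 0 1) eqM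
  |have := congr1 (fun M : 'M_2 => M 1 0) eqM
  |have := congr1 (fun M : 'M_2 => M 1 1) eqM]; by rewrite !mxE.
Qed.

Lemma mx2B a b c d a' b' c' d' :
  mx2 a b c d - mx2 a' b' c' d' = mx2 (a - a') (b - b') (c - c') (d - d').
Proof.
apply/matrixP=> k l; rewrite !mxE.
by case: (ord2 k) => ->; case: (ord2 l) => ->.
Qed.

Lemma mul_mx2_trig a b d a' b' d' :
  mx2 a b 0 d *m mx2 a' b' 0 d' = mx2 (a * a') (a * b' + b * d') 0 (d * d').
Proof.
have lift1 : lift ord0 ord0 = 1 :> 'I_2 by apply: val_inj.
apply/matrixP=> k l; rewrite !mxE !big_ord_recl big_ord0 lift1 !mxE.
by case: (ord2 k) => ->; case: (ord2 l) => -> /=;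
  rewrite ?mulr0 ?mul0r ?addr0 ?add0r.
Qed.

Lemma mx2_scalar a : a%:M = mx2 a 0 0 a.
Proof.
apply/matrixP=> k l; rewrite !mxE.
by case: (ord2 k) => ->; case: (ord2 l) => ->.
Qed.

End Matrix2.

(** * Upper triangular matrices and the minimality of U_p *)

Section UpperTriangularMatrices.

Variable F : fieldType.
Local Notation U := (upper_trig_ring F).

Lemma umx_subproof (a b d : F) : mx2 a b 0 d \in @upper_trig F.
Proof. by rewrite upper_trigE !mxE. Qed.

Definition umx a b d : U := Sub (mx2 a b 0 d) (umx_subproof a b d).

Lemma umxP (M : U) : exists a b d, M = umx a b d.
Proof.
exists (val M 0 0), (val M 0 1), (val M 1 1); apply: val_inj => /=.
have := valP M; rewrite upper_trigE => /eqP M10.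
by rewrite {1}[val M]mx2_eta M10.
Qed.

Lemma umx_inj a b d a' b' d' :
  umx a b d = umx a' b' d' -> [/\ a = a', b = b' & d = d'].
Proof. by move/(congr1 val)/mx2_inj => [-> -> _ ->]. Qed.

Lemma umxM a b d a' b' d' :
  umx a b d * umx a' b' d' = umx (a * a') (a * b' + b * d') (d * d').
Proof. by apply: val_inj; rewrite /= -mul_mx2_trig. Qed.

Lemma umxB a b d a' b' d' :
  umx a b d - umx a' b' d' = umx (a - a') (b - b') (d - d').
Proof. by apply: val_inj; rewrite /= mx2B subr0. Qed.

Lemma umxD a b d a' b' d' :
  umx a b d + umx a' b' d' = umx (a + a') (b + b') (d + d').
Proof. by apply: (addIr (- umx a' b' d')); rewrite addrK umxB !addrK. Qed.

Lemma umx0 : umx 0 0 0 = 0.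
Proof. by apply: val_inj; rewrite /= -mx2_scalar raddf0. Qed.

Lemma umx_natr n : n%:R = umx n%:R 0 n%:R :> U.
Proof.
elim: n => [|n IHn]; first by rewrite umx0.
have -> : umx n.+1%:R 0 n.+1%:R = umx n%:R 0 n%:R + umx 1 0 1.
  by rewrite umxD addr0 natr1.
by rewrite -natr1 IHn; congr (_ + _); apply: val_inj; rewrite /= -mx2_scalar.
Qed.

Lemma umx_comm a b d a' b' d' :
  umx a b d * umx a' b' d' - umx a' b' d' * umx a b d
  = umx 0 ((a - d) * b' - (a' - d') * b) 0.
Proof. by rewrite !umxM umxB; congr umx; ring. Qed.

(** Some entry of [z] is nonzero. Multiplying by suitable multiples of matrix units carries it to
    the upper right corner, rescaled to the corner [c] of the commutator. *)
Lemma umx_comm_ideal (z x y : U) :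
  z != 0 -> exists u v, u * z * v = x * y - y * x.
Proof.
have [a [b [d ->]]] := umxP z => z_neq0.
have [a1 [b1 [d1 ->]]] := umxP x; have [a2 [b2 [d2 ->]]] := umxP y.
rewrite umx_comm; set c := _ - _.
have [a0|a_neq0] := eqVneq a 0; last first.
  exists (umx 1 0 1), (umx 0 (c / a) 0); rewrite !umxM.
  by congr umx; field.
have [d0|d_neq0] := eqVneq d 0; last first.
  exists (umx 0 (c / d) 0), (umx 1 0 1); rewrite !umxM a0.
  by congr umx; field.
have b_neq0 : b != 0.
  by apply: contraNneq z_neq0 => b0; rewrite a0 b0 d0 umx0.
exists (umx (c / b) 0 0), (umx 0 0 1); rewrite !umxM a0 d0.
by congr umx; field.
Qed.

End UpperTriangularMatrices.

Lemma upper_trig_ring_minimal (p : nat) :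
  prime p -> minimal_noncommutative (upper_trig_ring 'F_p).
Proof.
move=> prp; split; last exact/noncommutative_quotients/umx_comm_ideal.
  move=> /(_ (umx 1 0 0) (umx 0 1 0)); rewrite !umxM => /umx_inj[_].
  by rewrite !(mulr0, mul0r, mul1r, addr0) => /eqP; rewrite oner_eq0.
move=> S Scl [M NSM] A B SA SB; apply/eqP/negPn/negP => ncAB.
case/negP: NSM; have [S1 SsubM SmulM] := Scl.
(* Over the prime field every scalar matrix is a natural multiple of 1; hence [S] is closed under
   scaling. *)
have Sscalar (k : 'F_p) : umx k 0 k \in S.
  by rewrite -[k]natr_Zp -umx_natr subring_closed_natr.
have SD := subring_closed_addr Scl.
have [a [b [d defA]]] := umxP A; have [a' [b' [d' defB]]] := umxP B.
have Sc : A * B - B * A \in S by apply: SsubM; apply: SmulM.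
move: ncAB; rewrite -subr_eq0; move: Sc.
rewrite defA defB umx_comm; set c := _ - _ => Sc c_neq0.
have {}c_neq0 : c != 0 by apply: contraNneq c_neq0 => ->; rewrite umx0.
have Snil t : umx 0 t 0 \in S.
  have := SmulM _ _ Sc (Sscalar (c^-1 * t)).
  by rewrite umxM !mul0r add0r mulVKf.
have Sidem : umx 1 0 0 \in S.
  (* Subtracting the e_12 part and the scalar [z] leaves (x - z) e_11, which is then divided by
     [x - z]. *)
  have diag x y z : umx x y z \in S -> x != z -> umx 1 0 0 \in S.
    move=> Sxyz x_neq_z; rewrite -subr_eq0 in x_neq_z.
    have := SmulM _ _ (SsubM _ _ (SsubM _ _ Sxyz (Snil y)) (Sscalar z))
      (Sscalar (x - z)^-1).
    by rewrite !umxB umxM; congr (_ \in S); congr umx; field.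
  (* If both [A] and [B] had constant diagonals, [c] would vanish. *)
  have [a_d|] := eqVneq a d; last by apply: (diag a b d); rewrite -defA.
  have [a'_d'|] := eqVneq a' d'; last by apply: (diag a' b' d'); rewrite -defB.
  by rewrite /c a_d a'_d' !subrr !mul0r subrr eqxx in c_neq0.
have [x [y [z ->]]] := umxP M.
(* Decomposition (x - z) e_11 + y e_12 + z of the arbitrary matrix [M]. *)
have := SD _ _ (SD _ _ (SmulM _ _ Sidem (Sscalar (x - z))) (Snil y)) (Sscalar z).
by rewrite umxM !umxD; congr (_ \in S); congr umx; ring.
Qed.

(** * Frobenius powers and generators of a finite field *)

Section FiniteField.

Variables (F : finFieldType) (p n : nat).
Hypotheses (prp : prime p) (cardF : #|F| = (p ^ n)%N).

Let chF : p \in [pchar F] := card_finPcharP cardF prp.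

Lemma expf_pow_dvd (x : F) d e :
  (d %| e)%N -> x ^+ (p ^ d) = x -> x ^+ (p ^ e) = x.
Proof.
case/dvdnP=> k ->{e} xd; elim: k => [|k IHk]; first by rewrite expr1.
by rewrite mulSn expnD exprM xd.
Qed.

(** The polynomial X^k - X has degree [k], too small to vanish on all of [F]. *)
Lemma exists_expf_neq k : (1 < k < #|F|)%N -> exists x : F, x ^+ k != x.
Proof.
case/andP=> k_gt1 k_ltF; apply/existsP; apply: contraLR k_ltF => /existsPn fixF.
rewrite -leqNgt cardE.
have sizeXX : size ('X^k - 'X : {poly F}) = k.+1.
  by rewrite size_polyDl size_polyXn // size_polyN size_polyX.
rewrite -ltnS -sizeXX max_poly_roots ?enum_uniq // -?size_poly_eq0 ?sizeXX //.
apply/allP=> x _; rewrite rootE !hornerE subr_eq0.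
by have := fixF x; rewrite negbK.
Qed.

(* A (p^n - 1)/(p^d - 1)-th power is fixed by [x |-> x^(p^d)]; if all of these
   were also fixed by [x |-> x^(p^r)] with [0 < r < d], a polynomial of degree
   less than p^n would vanish on F. *)
Lemma exists_subfield_moved d i : (d %| n)%N -> (0 < d)%N -> ~~ (d %| i)%N ->
  exists x : F, x ^+ (p ^ d) = x /\ x ^+ (p ^ i) != x.
Proof.
move=> d_n d_gt0 d_i; set r := (i %% d)%N.
have r_gt0 : (0 < r)%N by rewrite lt0n.
have r_ltd : (r < d)%N by rewrite ltn_mod.
have p_gt1 := prime_gt1 prp.
(* x |-> x^M is the norm from [F] to its subfield of order p^d. *)
have [M defM] : exists M, ((p ^ n).-1 = M * (p ^ d).-1)%N.
  by apply/dvdnP; case/dvdnP: d_n => k ->; rewrite mulnC expnM dvdn_pred_predX.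
have pX_gt0 k : (0 < p ^ k)%N by rewrite expn_gt0 prime_gt0.
have pred_gt0 k : (0 < k)%N -> (0 < (p ^ k).-1)%N.
  by move=> k_gt0; rewrite -subn1 subn_gt0 -(expn0 p) ltn_exp2l.
have n_gt0 : (0 < n)%N.
  by rewrite -(ltn_exp2l _ _ p_gt1) -cardF finNzRing_gt1.
have M_gt0 : (0 < M)%N.
  by have := pred_gt0 n n_gt0; rewrite defM muln_gt0 => /andP[].
(* Since 0 < r < d, this exponent lies strictly between 1 and M (p^d - 1) + 1 = p^n. *)
have [|y y_moved] := @exists_expf_neq (M * (p ^ r).-1).+1.
  rewrite ltnS muln_gt0 M_gt0 pred_gt0 //= cardF -(prednK (pX_gt0 n)).
  by rewrite defM ltnS ltn_pmul2l // -ltnS !prednK // ltn_exp2l.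
exists (y ^+ M); have yMd : (y ^+ M) ^+ (p ^ d) = y ^+ M.
  (* M p^d = M + (p^n - 1) = (M - 1) + p^n, and y^(p^n) = y. *)
  rewrite -exprM -[(p ^ d)%N]prednK // mulnS -defM.
  rewrite -{1}(prednK M_gt0) addSnnS prednK //.
  by rewrite exprD -cardF expf_card -exprSr prednK.
split=> //; apply: contraNneq y_moved => yMi.
have {yMi} : (y ^+ M) ^+ (p ^ r) = y ^+ M.
  (* The multiple of [d] contained in [i] already fixes [y ^+ M]; only the remainder [r] acts. *)
  rewrite -[RHS]yMi [in RHS](divn_eq i d) expnD [RHS]exprM.
  by rewrite (expf_pow_dvd (dvdn_mull _ (dvdnn d)) yMd).
have [->|y_neq0] := eqVneq y 0; first by rewrite [0 ^+ _.+1]expr0n.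
rewrite -{1}[(p ^ r)%N]prednK // exprS -[RHS]mulr1.
by move/(mulfI (expf_neq0 M y_neq0)); rewrite -exprM exprS => ->; rewrite mulr1.
Qed.

(** A subring containing [a] contains F_p[a], which is a subfield because [F] is finite; lying in no
    proper subfield, [a] generates [F]. *)
Lemma subring_generated (K : {pred F}) a : subring_closed K -> a \in K ->
    (forall d, (d %| n)%N -> (d < n)%N -> a ^+ (p ^ d) != a) ->
  forall x, x \in K.
Proof.
move=> Kcl Ka a_gen x.
pose L : splittingFieldType 'F_p := pPrimeCharType chF.
pose E : {subfield L} := <<1; a : L>>%AS.
have dimL : \dim {:L} = n by rewrite pprimeChar_dimf cardF pfactorK.
have dimE : \dim E = n.
  apply/eqP; rewrite eqn_leq -{1}dimL dimvS ?subvf //= leqNgt.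
  (* Otherwise [\dim E] is a proper divisor of [n], and every element of [E], in particular [a], is
     fixed by x |-> x^(p^(dim E)). *)
  apply/negP=> ltEn; have := a_gen (\dim E); rewrite -dimL field_dimS ?subvf //.
  rewrite dimL => /(_ isT ltEn)/eqP[].
  have := Fermat's_little_theorem E (a : L); rewrite memv_adjoin card_Fp //.
  by move/esym/eqP.
have Ex : (x : L) \in E.
  have /eqP -> : E == {:L}%VS :> {vspace L} by rewrite eqEdim subvf dimL dimE /=.
  exact: memvf.
case/Fadjoin_polyP: Ex => q /polyOver1P[c ->] ->.
rewrite horner_coef; have [_ SB SM] := Kcl.
apply: (big_ind (fun t : L => t \in K)) => [|s t|k _].
- exact: subring_closed_natr 0 Kcl.
- exact: subring_closed_addr Kcl s t.
(* Coefficients in F_p act as natural multiples of 1, so they lie in [K]. *)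
rewrite coef_map; apply: SM; last exact: subring_closed_expr.
by rewrite /= /GRing.scale /= /pprimeChar_scale mulr1 subring_closed_natr.
Qed.

End FiniteField.

(** * The rings B_{p,n,i} and their subrings *)

Section FrobeniusMatrices.

Variables (F : finFieldType) (p : nat) (chF : p \in [pchar F]) (i : nat).
Local Notation B := (Bring chF i).
Local Notation sigma x := (x ^+ (p ^ i)).

Lemma bmx_subproof (x y : F) : mx2 (sigma x) y 0 x \in Bpred chF i.
Proof. by apply/BpredP; exists x, y. Qed.

Definition bmx x y : B := Sub (mx2 (sigma x) y 0 x) (bmx_subproof x y).

Lemma bmxP (M : B) : exists x y, M = bmx x y.
Proof.
have /BpredP[x [y defM]] := valP M; exists x, y.
by apply: val_inj; rewrite defM.
Qed.

Lemma bmx_inj x y x' y' : bmx x y = bmx x' y' -> x = x' /\ y = y'.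
Proof. by move/(congr1 val)/mx2_inj => [_ -> _ ->]. Qed.

Lemma sigmaB (x y : F) : sigma (x - y) = sigma x - sigma y.
Proof.
have pF : [pchar F].-nat (p ^ i)%N.
  by rewrite pnatX pnatE ?(pcharf_prime chF) // chF.
by rewrite exprDn_pchar // exprNn_pchar.
Qed.

Lemma sigma0 : sigma 0 = 0 :> F.
Proof. by rewrite -{1}(subrr 0) sigmaB subrr. Qed.

Lemma bmxM x y x' y' :
  bmx x y * bmx x' y' = bmx (x * x') (sigma x * y' + y * x').
Proof. by apply: val_inj; rewrite /= exprMn -mul_mx2_trig. Qed.

Lemma bmxB x y x' y' : bmx x y - bmx x' y' = bmx (x - x') (y - y').
Proof. by apply: val_inj; rewrite /= mx2B subr0 sigmaB. Qed.

Lemma bmx0 : bmx 0 0 = 0.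
Proof. by apply: val_inj; rewrite /= sigma0 -mx2_scalar raddf0. Qed.

Lemma bmx1 : bmx 1 0 = 1.
Proof. by apply: val_inj; rewrite /= expr1n -mx2_scalar. Qed.

Lemma bmx_comm x y x' y' :
  bmx x y * bmx x' y' - bmx x' y' * bmx x y
  = bmx 0 ((sigma x - x) * y' - (sigma x' - x') * y).
Proof. by rewrite !bmxM bmxB; congr bmx; ring. Qed.

(** Right multiples suffice: a nonzero diagonal of [z] is multiplied by a multiple of e_12, and a
    pure multiple of e_12 is rescaled by a diagonal matrix. *)
Lemma bmx_comm_ideal (z x y : B) :
  z != 0 -> exists u v, u * z * v = x * y - y * x.
Proof.
have [a [b ->]] := bmxP z => z_neq0.
have [x1 [y1 ->]] := bmxP x; have [x2 [y2 ->]] := bmxP y.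
rewrite bmx_comm; set c := _ - _; exists 1.
have [a0|a_neq0] := eqVneq a 0; last first.
  exists (bmx 0 (c / sigma a)); rewrite mul1r bmxM !mulr0 addr0.
  by rewrite mulrCA divff ?mulr1 ?expf_neq0.
have b_neq0 : b != 0.
  by apply: contraNneq z_neq0 => b0; rewrite a0 b0 bmx0.
exists (bmx (c / b) 0); rewrite mul1r bmxM a0 mul0r mulr0 add0r.
by rewrite mulrCA divff ?mulr1.
Qed.

Lemma Bring_noncommutative :
  (exists a : F, sigma a != a) -> ~ commutative (@GRing.mul B).
Proof.
case=> a /eqP a_moved /(_ (bmx a 0) (bmx 0 1)); rewrite !bmxM => /bmx_inj[_].
by rewrite sigma0 !(mulr0, mul0r, mulr1, mul1r, addr0, add0r).
Qed.

(** The image of [S] under the ring morphism from [B] to [F] taking the lower diagonal entry. *)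
Definition diag_in (S : {pred B}) : {pred F} :=
  [pred x | [exists y, bmx x y \in S]].

Lemma diag_in_closed S : subring_closed S -> subring_closed (diag_in S).
Proof.
case=> S1 SB SM; split=> [|x x' /existsP[y Sxy] /existsP[y' Sxy']
                          |x x' /existsP[y Sxy] /existsP[y' Sxy']];
  apply/existsP.
- by exists 0; rewrite bmx1.
- by exists (y - y'); rewrite -bmxB SB.
- by exists (sigma x * y' + y * x'); rewrite -bmxM SM.
Qed.

(** A nonzero commutator forces a diagonal entry moved by [sigma], so by the assumption on [K] the
    lower diagonal entries fill [F]. *)
Lemma noncommutative_subring_full (S : {pred B}) :
    (forall (K : {pred F}) a, subring_closed K -> a \in K -> sigma a != a ->
      forall x, x \in K) ->
    subring_closed S -> ~ {in S &, commutative (@GRing.mul B)} ->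
  forall M, M \in S.
Proof.
move=> K_full Scl ncS M; apply/negPn/negP => /negP NSM; case: ncS => P Q SP SQ.
have [S1 SB SM] := Scl.
have [x [y defP]] := bmxP P; have [x' [y' defQ]] := bmxP Q.
apply/eqP/negPn/negP; rewrite -subr_eq0.
have Sc : P * Q - Q * P \in S by apply: SB; apply: SM.
move: Sc; rewrite defP defQ bmx_comm; set c := _ - _ => Sc c_neq0.
have {}c_neq0 : c != 0 by apply: contraNneq c_neq0 => ->; rewrite bmx0.
case: NSM; have full t : exists u, bmx t u \in S.
  apply/existsP; have Kcl := diag_in_closed Scl.
  have [x_fixed|] := eqVneq (sigma x) x; last first.
    by move/(K_full _ _ Kcl); apply; apply/existsP; exists y; rewrite -defP.
  have [x'_fixed|] := eqVneq (sigma x') x'; last first.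
    by move/(K_full _ _ Kcl); apply; apply/existsP; exists y'; rewrite -defQ.
  by rewrite /c x_fixed x'_fixed !subrr !mul0r subrr eqxx in c_neq0.
have Snil t : bmx 0 t \in S.
  (* Right multiplication of the commutator by a lift of [t / c] kills the unknown corner [u]. *)
  have [u Su] := full (t / c); have := SM _ _ Sc Su.
  by rewrite bmxM sigma0 !mul0r add0r mulrCA divff ?mulr1.
have [t [v ->]] := bmxP M; have [u Su] := full t.
by have := SB _ _ Su (Snil (u - v)); rewrite bmxB subr0 opprB addrCA subrr addr0.
Qed.

(** For [d] dividing [n], the lower diagonal entry is confined to F_{p^d} and the corner stays
    free. *)
Definition diag_fixed d : {pred B} :=
  [pred M : B | (val M : 'M_2) 1 1 ^+ (p ^ d) == (val M : 'M_2) 1 1].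

Lemma mem_diag_fixed d x y : (bmx x y \in diag_fixed d) = (x ^+ (p ^ d) == x).
Proof. by rewrite inE /= !mxE. Qed.

End FrobeniusMatrices.

Arguments bmx {F p} chF i x y.
Arguments diag_fixed {F p} chF i d.

Lemma diag_fixed_closed (F : finFieldType) (p : nat) (chF : p \in [pchar F])
    (i d : nat) :
  subring_closed (diag_fixed chF i d).
Proof.
split=> [|A B|A B]; first by rewrite -bmx1 mem_diag_fixed expr1n.
all: have [x [y ->]] := bmxP A; have [x' [y' ->]] := bmxP B.
all: rewrite ?bmxB ?bmxM !mem_diag_fixed => /eqP xd /eqP xd'.
  by rewrite (sigmaB chF) xd xd'.
by rewrite exprMn xd xd'.
Qed.

Lemma Bring_minimal_iff_dvdn (F : finFieldType) (p n : nat) (prp : prime p)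
    (cardF : #|F| = (p ^ n)%N) i :
    (1 <= i < n)%N ->
  minimal_noncommutative (Bring (card_finPcharP cardF prp) i) <->
  (forall d, (d %| n)%N -> (d < n)%N -> (d %| i)%N).
Proof.
case/andP=> i_gt0 i_ltn; set chF := card_finPcharP cardF prp.
have p_gt1 := prime_gt1 prp.
have moved d : (0 < d < n)%N -> exists x : F, x ^+ (p ^ d) != x.
  case/andP=> d_gt0 d_ltn; apply: exists_expf_neq.
  by rewrite cardF -(expn0 p) !ltn_exp2l // d_gt0.
split=> [[_ comm_sub _] d d_n d_ltn | dvd_i].
  have d_gt0 : (0 < d)%N by apply: dvdn_gt0 d_n; apply: leq_trans i_ltn.
  apply/negPn/negP => d_i.
  have [x [xd xi]] := exists_subfield_moved prp cardF d_n d_gt0 d_i.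
  (* An element outside F_{p^d} shows that the subring is proper. *)
  have [y yd] : exists y : F, y ^+ (p ^ d) != y by apply: moved; rewrite d_gt0.
  have proper : exists M, M \notin diag_fixed chF i d.
    by exists (bmx chF i y 0); rewrite mem_diag_fixed.
  have comm := comm_sub _ (diag_fixed_closed chF i d) proper.
  have := comm (bmx chF i x 0) (bmx chF i 0 1).
  rewrite !mem_diag_fixed xd (sigma0 chF) !eqxx.
  move=> /(_ isT isT); rewrite !bmxM => /bmx_inj[_ /eqP].
  by rewrite mulr1 !mul0r addr0 mul1r mulr0 add0r (negPf xi).
split; last exact/noncommutative_quotients/bmx_comm_ideal.
  by apply/Bring_noncommutative/moved; rewrite i_gt0.
move=> S Scl [M NSM] P Q SP SQ; apply/eqP/negPn/negP => /eqP ncPQ.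
case/negP: NSM; apply: noncommutative_subring_full Scl _ M => [K a Kcl Ka ai|].
  apply: (subring_generated prp cardF Kcl Ka) => d d_n d_ltn.
  (* As [d] divides [i], an [a] in F_{p^d} would be fixed by x |-> x^(p^i). *)
  by apply: contraNneq ai => ad; rewrite (expf_pow_dvd (dvd_i d d_n d_ltn) ad).
by move/(_ P Q SP SQ).
Qed.

End Auxiliary.

(** * The arithmetic condition on n and i *)

(** If [n] were not a prime power, it would split into coprime proper divisors, both dividing [i],
    so [n] would divide the smaller [i]. For n = q^m, the largest proper divisor is q^(m-1). *)
Lemma prime_power_of_proper_divisors n i : 1 < n -> 0 < i < n ->
  (forall d, d %| n -> d < n -> d %| i) <->
  exists q m j : nat,
    [/\ prime q, 1 <= m, 1 <= j <= q.-1, n = q ^ m & i = j * q ^ m.-1].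
Proof.
move=> n_gt1 /andP[i_gt0 i_ltn]; split=> [dvd_i|]; last first.
  case=> q [m] [j] [prq m_gt0 _ -> ->] d /(dvdn_pfactor _ _ prq)[e _ ->].
  rewrite ltn_exp2l ?prime_gt1 // -[m in _ < m]prednK // => le_em.
  by apply: dvdn_mull; apply: dvdn_exp2l.
have n_gt0 : 0 < n by apply: ltnW.
have [q prq q_n] : exists2 q, prime q & q %| n.
  by exists (pdiv n); rewrite ?pdiv_prime ?pdiv_dvd.
have [m [k [m_gt0 q_k def_n]]] :
    exists m k, [/\ 0 < m, coprime q k & n = k * q ^ m].
  have [k q_k def_n] := pfactor_coprime prq n_gt0.
  by exists (logn q n), k; rewrite logn_gt0 mem_primes prq n_gt0.
have qm_gt1 : 1 < q ^ m by rewrite -(expn0 q) ltn_exp2l ?prime_gt1.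
have [k1|k_neq1] := eqVneq k 1; last first.
  have k_gt0 : 0 < k by move: n_gt0; rewrite def_n muln_gt0 => /andP[].
  have k_gt1 : 1 < k by rewrite ltn_neqAle eq_sym k_neq1.
  have : n %| i.
    rewrite def_n Gauss_dvd ?coprimeXr 1?coprime_sym //.
    have lt_kn : k < n by rewrite def_n -[ltnLHS]muln1 ltn_pmul2l.
    have lt_qn : q ^ m < n.
      by rewrite [ltnRHS]def_n -[ltnLHS]mul1n ltn_pmul2r // ltnW.
    have k_n : k %| n by rewrite def_n dvdn_mulr.
    have qm_n : q ^ m %| n by rewrite def_n dvdn_mull.
    by rewrite !dvd_i.
  by move/(dvdn_leq i_gt0); rewrite leqNgt i_ltn.
rewrite k1 mul1n in def_n.
have /dvdnP[j def_i] : q ^ m.-1 %| i.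
  apply: dvd_i; rewrite def_n.
    by rewrite dvdn_exp2l ?leq_pred.
  by rewrite ltn_exp2l ?prime_gt1 // prednK.
exists q, m, j; split=> //; move: i_gt0 i_ltn; rewrite def_i muln_gt0.
(* Cancelling q^(m-1) in j q^(m-1) < q q^(m-1) gives j < q. *)
case/andP=> j_gt0 _; rewrite [n in _ < n]def_n -{2}(prednK m_gt0) expnS.
have q_gt0 := prime_gt0 prq.
by rewrite ltn_pmul2r ?expn_gt0 ?q_gt0 // j_gt0 -[j <= _]ltnS prednK.
Qed.

Theorem proposition2p1 (p : nat) (prp : prime p) :
  minimal_noncommutative (upper_trig_ring 'F_p) /\
  (forall (n i : nat) (F : finFieldType) (cardF : #|F| = p ^ n),
     2 <= n -> 1 <= i <= n.-1 ->
     (minimal_noncommutative (Bring (card_finPcharP cardF prp) i) <->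
      exists q m j : nat,
        [/\ prime q, 1 <= m, 1 <= j <= q.-1, n = q ^ m & i = j * q ^ m.-1])).
Proof.
split=> [|n i F cardF n_gt1]; first exact: upper_trig_ring_minimal.
rewrite -[i <= _]ltnS (ltn_predK n_gt1) => i_n.
apply: iff_trans (Bring_minimal_iff_dvdn prp cardF i_n) _.
exact: prime_power_of_proper_divisors.
Qed.
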